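(* Let $F:\mathbb N_0\to\mathbb N_0$ be an automorphism (a bijection with $\mu_{F(j)}=\mu_j$ for all $j$) and let $U_F$ be its Koopman operator on $l^2(\mathbb N_0,\mu)$. Then $\mathfrak H(U_F)=\mathfrak h(U_F)=0$.
   Context: Let $\mu_j>0$ ($j\in\mathbb N_0=\{0,1,\dots\}$) with $\sum_j\mu_j=1$. $\mathcal H=l^2(\mathbb N_0,\mu)$ is the Hilbert space of complex sequences with $\langle x,y\rangle=\sum_j\mu_jx_j\overline{y_j}$. The Koopman operator of $F$ is $U_Fx=x\circ F$, i.e. $(U_Fx)_j=x_{F(j)}$. For a contraction $U$ on $\mathcal H$ let $(Ux)_j=\sum_kU_{jk}x_k$ and $\mathbf B=b(U)$, $\mathbf B_{jk}=\frac{\mu_j}{\mu_k}|U_{jk}|^2$; convention $0\log0=0$. Entropy $\mathfrak h(U)$: for a finite partition $\chi=\{X_0,\dots,X_K\}$ of $\mathbb N_0$, $n\ge1$ and $\sigma\in\mathcal S_{n,K}$ (maps $\{0,\dots,n\}\to\{0,\dots,K\}$) put $$\mathcal I_U(\mathbf G_\sigma)=\sum_{j_0,\dots,j_n\in\mathbb N_0}\mathbf 1_{X_{\sigma(n)}}(j_n)\,\mathbf B_{j_nj_{n-1}}\mathbf 1_{X_{\sigma(n-1)}}(j_{n-1})\cdots\mathbf B_{j_1j_0}\mathbf 1_{X_{\sigma(0)}}(j_0)\,\mu_{j_0},$$ $\mathfrak h(U,\chi,n)=-\sum_{\sigma\in\mathcal S_{n,K}}\mathcal I_U(\mathbf G_\sigma)\log\mathcal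 I_U(\mathbf G_\sigma)$, $\mathfrak h(U,\chi)=\lim_{n\to\infty}\frac1n\mathfrak h(U,\chi,n)$ (when it exists), $\mathfrak h(U)=\sup_\chi\mathfrak h(U,\chi)$. $\mathfrak H(U)$: let $\mathbf B_J=(\mathbf B_{jk})_{0\le j,k<J}$ and let $\mathcal P_J$ be the projection of $\mathbb C^J$ onto $\mathrm{Ker}(\mathbf B_J-I)$ along $\mathrm{Im}(\mathbf B_J-I)$. Put $\mathfrak h(U_J)=-\sum_{j,k=0}^{J-1}(\mathcal P_J^Te)_j(\mathbf B_J)_{jk}(\mathcal P_J\mu^{(J)})_k\log(\mathbf B_J)_{jk}$ with $e=(1,\dots,1)$, $\mu^{(J)}=(\mu_0,\dots,\mu_{J-1})$ (the entropy of the truncation $U_J=(U_{jk})_{j,k<J}$ on $\mathbb C^J$), and $\mathfrak H(U)=\lim_{J\to\infty}\mathfrak h(U_J)$. *)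

(* Defs.v *)
From HB Require Import structures.
From mathcomp Require Import all_boot all_order all_algebra.
From mathcomp Require Import complex ring lra.
From mathcomp Require Import all_classical all_reals all_analysis.

Set Implicit Arguments.
Unset Strict Implicit.
Unset Printing Implicit Defensive.

Import Order.TTheory GRing.Theory Num.Theory.
Import numFieldNormedType.Exports.

Local Open Scope classical_set_scope.
Local Open Scope ring_scope.
Local Open Scope complex_scope.

Record weights (R : realType) := Weights {
  weight :> nat -> R;
  weight_gt0 : forall j, 0 < weight j;
  weight_sum1 : (\sum_(0 <= j <oo) (weight j)%:E = 1)%E }.

Definition cmod (R : realType) (z : R[i]) : R := ComplexField.Normc.normc z.

Arguments cmod : simpl never.

Lemma cmod0 (R : realType) : cmod (0 : R[i]) = 0.
Proof. exact: ComplexField.Normc.normc0. Qed.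

Lemma cmod1 (R : realType) : cmod (1 : R[i]) = 1.
Proof. exact: ComplexField.Normc.normc1. Qed.

Lemma cmod_ge0 (R : realType) (z : R[i]) : 0 <= cmod z.
Proof. by case: z => a b; exact: sqrtr_ge0. Qed.

Lemma cmodM (R : realType) (x y : R[i]) : cmod (x * y) = cmod x * cmod y.
Proof. exact: ComplexField.Normc.normcM. Qed.

Lemma cmodD (R : realType) (x y : R[i]) : cmod (x + y) <= cmod x + cmod y.
Proof. exact: le_normcD. Qed.

Definition l2sum (R : realType) (mu : weights R) (x : nat -> R[i]) : \bar R :=
  (\sum_(0 <= j <oo) (mu j * cmod (x j) ^+ 2)%:E)%E.

Definition in_l2 (R : realType) (mu : weights R) : pred (nat -> R[i]) :=
  fun x => `[< (l2sum mu x < +oo)%E >].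

Lemma l2term_ge0 (R : realType) (mu : weights R) (x : nat -> R[i]) j :
  (0 <= (mu j * cmod (x j) ^+ 2)%:E)%E.
Proof. by rewrite lee_fin mulr_ge0 ?sqr_ge0// ltW// weight_gt0. Qed.

Lemma l2sum_ge0 (R : realType) (mu : weights R) x : (0 <= l2sum mu x)%E.
Proof. by apply: nneseries_ge0 => j _ _; exact: l2term_ge0. Qed.

Lemma in_l2_submod_closed (R : realType) (mu : weights R) :
  submod_closed (in_l2 mu).
Proof.
split.
  apply/asboolP; rewrite /l2sum eseries0 ?ltry// => j _ _.
  by rewrite cmod0 expr0n mulr0.
move=> a x y /asboolP xl /asboolP yl; apply/asboolP.
pose c : R := 2 * cmod a ^+ 2.
have c0 : 0 <= c by rewrite mulr_ge0 ?sqr_ge0.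
apply: (@le_lt_trans _ _ (c%:E * l2sum mu x + 2%:E * l2sum mu y)%E); last first.
  rewrite lte_add_pinfty// lte_mul_pinfty ?lee_fin//.
rewrite /l2sum -!nneseriesZl; [|by move=> *; exact: l2term_ge0..].
rewrite -nneseriesD; last 2 first.
- by move=> i _ _; rewrite mule_ge0 ?lee_fin// -lee_fin l2term_ge0.
- by move=> i _ _; rewrite mule_ge0 ?lee_fin// -lee_fin l2term_ge0.
apply: lee_nneseries => [i _ _|i _]; first exact: l2term_ge0.
rewrite -!EFinM -EFinD lee_fin.
rewrite [leRHS](_ : _ = mu i * (2 * (cmod a * cmod (x i)) ^+ 2 + 2 * cmod (y i) ^+ 2)); last first.
  rewrite /c exprMn mulrDr; congr +%R; first by rewrite mulrCA !mulrA.
  by rewrite mulrCA.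
rewrite ler_wpM2l ?(ltW (weight_gt0 mu i))//.
have := cmodD (a * x i) (y i); rewrite cmodM => h.
apply: (@le_trans _ _ ((cmod a * cmod (x i) + cmod (y i)) ^+ 2)).
  rewrite ler_sqr ?nnegrE ?addr_ge0 ?mulr_ge0 ?cmod_ge0//.
rewrite -subr_ge0.
rewrite (_ : _ - _ = (cmod a * cmod (x i) - cmod (y i)) ^+ 2) ?sqr_ge0//.
by rewrite sqrrD sqrrB !mulr2n !mulrDl !mul1r; ring.
Qed.

HB.instance Definition _ (R : realType) (mu : weights R) :=
  GRing.isSubmodClosed.Build R[i] (nat -> R[i]) (in_l2 mu)
    (in_l2_submod_closed mu).

Record l2 (R : realType) (mu : weights R) := L2 {
  l2_val :> nat -> R[i];
  l2_valP : l2_val \in in_l2 mu }.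

HB.instance Definition _ (R : realType) (mu : weights R) :=
  [isSub for @l2_val R mu].
HB.instance Definition _ (R : realType) (mu : weights R) :=
  [Choice of l2 mu by <:].
HB.instance Definition _ (R : realType) (mu : weights R) :=
  [SubChoice_isSubLmodule of l2 mu by <:].

Definition l2norm (R : realType) (mu : weights R) (x : l2 mu) : R :=
  Num.sqrt (fine (l2sum mu x)).

Record contraction (R : realType) (mu : weights R) := Contraction {
  contraction_op :> {linear l2 mu -> l2 mu};
  contraction_le : forall x, l2norm (contraction_op x) <= l2norm x }.

Lemma l2sum_delta (R : realType) (mu : weights R) (k : nat) :
  l2sum mu (fun j => (j == k)%:R) = (mu k)%:E.
Proof.
rewrite /l2sum (@nneseriesD1 _ _ k)//; last first.
  by move=> j _; exact: (l2term_ge0 mu (fun i => (i == k)%:R)).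
rewrite eqxx cmod1 expr1n mulr1 eseries0 ?adde0// => j _ /= /negPf ->.
by rewrite cmod0 expr0n mulr0.
Qed.

Lemma in_l2_delta (R : realType) (mu : weights R) (k : nat) :
  (fun j => (j == k)%:R) \in in_l2 mu.
Proof. by apply: asboolT; rewrite l2sum_delta ltry. Qed.

Definition l2_delta (R : realType) (mu : weights R) (k : nat) : l2 mu :=
  L2 (in_l2_delta mu k).

(* The matrix of U, (U x)_j = \sum_k U_jk x_k. *)
Definition op_entry (R : realType) (mu : weights R) (U : contraction mu)
  (j k : nat) : R[i] := U (l2_delta mu k) j.

Definition bmap (R : realType) (mu : weights R) (U : contraction mu)
  (j k : nat) : R := mu j / mu k * cmod (op_entry U j k) ^+ 2.

Lemma bmap_ge0 (R : realType) (mu : weights R) (U : contraction mu) j k :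
  0 <= bmap U j k.
Proof.
by rewrite /bmap mulr_ge0 ?sqr_ge0// divr_ge0// ltW// weight_gt0.
Qed.

Lemma l2sum_fin (R : realType) (mu : weights R) (x : l2 mu) :
  l2sum mu x \is a fin_num.
Proof.
rewrite ge0_fin_numE ?l2sum_ge0//.
by case: x => f fP; exact: (asboolP _ fP).
Qed.

Lemma bmap_col_le1 (R : realType) (mu : weights R) (U : contraction mu) J k :
  \sum_(0 <= j < J) bmap U j k <= 1.
Proof.
have h : fine (l2sum mu (U (l2_delta mu k))) <= mu k.
  have := contraction_le U (l2_delta mu k).
  rewrite /l2norm ler_psqrt ?nnegrE ?fine_ge0 ?l2sum_ge0// => /le_trans; apply.
  by rewrite l2sum_delta.
have mk := weight_gt0 mu k.
apply: (@le_trans _ _ ((mu k)^-1 * fine (l2sum mu (U (l2_delta mu k))))).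
  rewrite (_ : \sum_(0 <= j < J) bmap U j k = (mu k)^-1 *
      \sum_(0 <= j < J) (mu j * cmod (op_entry U j k) ^+ 2)); last first.
    rewrite big_distrr; apply: eq_bigr => j _.
    by rewrite /bmap mulrAC mulrC.
  rewrite ler_wpM2l ?invr_ge0 ?(ltW mk)// -lee_fin fineK ?l2sum_fin//.
  rewrite -sumEFin; apply: nneseries_lim_ge => j _ _; exact: l2term_ge0.
by rewrite mulrC ler_pdivrMr ?mul1r.
Qed.

(* X : 'I_K.+1 -> set nat is the family X_0, ..., X_K.  Since B has
   nonnegative entries and column sums at most 1 (bmap_col_le1), the sum of
   nonnegative terms below is at most \sum_j mu j = 1, so [fine] is harmless. *)
Definition path_weight (R : realType) (mu : weights R) (U : contraction mu)
    (K : nat) (X : 'I_K.+1 -> set nat) (n : nat)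
    (s : {ffun 'I_n.+1 -> 'I_K.+1}) : R :=
  fine (\esum_(j in [set: {ffun 'I_n.+1 -> nat}])
    ((\prod_(i < n.+1) (\1_(X (s i)) (j i) : R)) *
     (\prod_(i < n) bmap U (j (inord i.+1)) (j (inord i))) *
     mu (j ord0))%:E).

Definition block_entropy (R : realType) (mu : weights R) (U : contraction mu)
    (K : nat) (X : 'I_K.+1 -> set nat) (n : nat) : R :=
  - \sum_(s : {ffun 'I_n.+1 -> 'I_K.+1})
      path_weight U X s * ln (path_weight U X s).

Definition entropy_rate_seq (R : realType) (mu : weights R)
    (U : contraction mu) (K : nat) (X : 'I_K.+1 -> set nat) : R^nat :=
  fun n => n%:R^-1 * block_entropy U X n.

(* Meaningful when [entropy_rate_seq U X] converges. *)
Definition entropy_rate (R : realType) (mu : weights R) (U : contraction mu)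
    (K : nat) (X : 'I_K.+1 -> set nat) : R :=
  limn (entropy_rate_seq U X).

(* The fraktur h(U). *)
Definition entropy (R : realType) (mu : weights R) (U : contraction mu) :
    \bar R :=
  ereal_sup [set h | exists (K : nat) (X : 'I_K.+1 -> set nat),
    partition [set: 'I_K.+1] X [set: nat] /\ h = (entropy_rate U X)%:E].

Definition trunc_bmap (R : realType) (mu : weights R) (U : contraction mu)
    (J : nat) : 'M[R[i]]_J :=
  \matrix_(j, k) (bmap U j k)%:C.

(* [proj_mx A B] projects row vectors onto the row space of A along that of B;
   for M acting on column vectors, Ker M and Im M are, up to transposition, the
   row spaces of [kermx M^T] and of [M^T]. *)
Definition ker_im_proj (F : fieldType) (J : nat) (M : 'M[F]_J) : 'M[F]_J :=
  (proj_mx (kermx M^T) M^T)^T.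

Definition trunc_proj (R : realType) (mu : weights R) (U : contraction mu)
    (J : nat) : 'M[R[i]]_J := ker_im_proj (trunc_bmap U J - 1%:M).

Lemma bmap_row_norm (R : realType) (mu : weights R) (U : contraction mu)
    (J : nat) (u : 'rV[R[i]]_J) :
  \sum_j cmod ((u *m (trunc_bmap U J)^T) 0 j) <= \sum_j cmod (u 0 j).
Proof.
apply: (@le_trans _ _ (\sum_(j < J) \sum_(k < J) cmod (u 0 k) * bmap U j k)).
  apply: ler_sum => j _; rewrite mxE.
  apply: (big_ind2 (fun (x : R[i]) (y : R) => cmod x <= y)).
  - by rewrite cmod0.
  - move=> x1 y1 x2 y2 h1 h2; exact: le_trans (cmodD _ _) (lerD h1 h2).
  - move=> k _; rewrite !mxE cmodM ler_wpM2l ?cmod_ge0//.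
    by rewrite /cmod /= expr0n addr0 sqrtr_sqr ger0_norm// bmap_ge0.
rewrite exchange_big /=; apply: ler_sum => k _; rewrite -mulr_sumr.
rewrite ler_piMr ?cmod_ge0//.
by have := bmap_col_le1 U J k; rewrite big_mkord.
Qed.

Lemma ker_im_proj_cap (R : realType) (mu : weights R) (U : contraction mu)
    (J : nat) :
  (kermx (trunc_bmap U J - 1%:M)^T :&: (trunc_bmap U J - 1%:M)^T = 0)%MS.
Proof.
set M := _ - 1%:M.
apply/eqP/rowV0P => v; rewrite sub_capmx => /andP[/sub_kermxP vM /submxP[w vw]].
set B := (trunc_bmap U J)^T.
have MB : M^T = B - 1%:M by rewrite /M linearB /= trmx1.
have vB : v *m B = v.
  by apply/eqP; rewrite -subr_eq0 -[X in _ - X]mulmx1 -mulmxBr -MB vM.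
have wB : w *m B = w + v.
  by rewrite vw MB mulmxBr mulmx1 addrC subrK.
pose N (u : 'rV[R[i]]_J) := \sum_j cmod (u 0 j).
have Nn n : N (w + n%:R *: v) <= N w.
  elim: n => [|n IH]; first by rewrite scale0r addr0.
  apply: le_trans IH; rewrite (_ : w + n.+1%:R *: v = (w + n%:R *: v) *m B).
    exact: bmap_row_norm.
  by rewrite mulmxDl wB -scalemxAl vB -addrA -[in LHS]natr1 scalerDl scale1r
             [v + _]addrC.
have ND x y : N (x + y) <= N x + N y.
  by rewrite -big_split; apply: ler_sum => j _; rewrite mxE cmodD.
have NZ a x : N (a *: x) = cmod a * N x.
  by rewrite mulr_sumr; apply: eq_bigr => j _; rewrite mxE cmodM.
have cn n : cmod (n%:R : R[i]) = n%:R.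
  by rewrite -(rmorph_nat (real_complex R)) /cmod /= expr0n addr0 sqrtr_sqr normr_nat.
have cN1 : cmod (-1 : R[i]) = 1.
  by rewrite /cmod /= oppr0 expr0n addr0 sqrrN expr1n sqrtr1.
have Nv n : n%:R * N v <= N w + N w.
  rewrite -cn -NZ -[n%:R *: v](addKr w) addrC.
  apply: le_trans (ND _ _) _; rewrite lerD// -scaleN1r NZ cN1 mul1r//.
have N0 u : 0 <= N u by apply: sumr_ge0 => j _; exact: cmod_ge0.
have Nv0 : N v = 0.
  apply/eqP; rewrite eq_le N0 andbT leNgt; apply/negP => Nvp.
  have := archi_boundP (divr_ge0 (addr_ge0 (N0 w) (N0 w)) (N0 v)).
  by rewrite ltNge ler_pdivlMr// Nv.
apply/rowP => j; rewrite mxE; apply: ComplexField.Normc.eq0_normc.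
by move/eqP: Nv0; rewrite psumr_eq0 => [/allP/(_ j (mem_index_enum _))/eqP//|k _];
  exact: cmod_ge0.
Qed.

(* B_J is real, hence so is the complex number below (trunc_entropyCE); taking
   its real part only changes its type. *)
Definition trunc_entropyC (R : realType) (mu : weights R) (U : contraction mu)
    (J : nat) : R[i] :=
  - \sum_(j < J) \sum_(k < J)
      ((trunc_proj U J)^T *m (const_mx 1 : 'cV_J)) j 0 * trunc_bmap U J j k *
      (trunc_proj U J *m (\col_i (mu i)%:C)) k 0 * (ln (bmap U j k))%:C.

Definition trunc_entropy (R : realType) (mu : weights R) (U : contraction mu)
    (J : nat) : R :=
  complex.Re (trunc_entropyC U J).

Lemma trunc_projE (R : realType) (mu : weights R) (U : contraction mu)
    (J : nat) :
  trunc_proj U J =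
  map_mx (real_complex R) (ker_im_proj (\matrix_(j, k) bmap U j k - 1%:M)).
Proof.
set Q : 'M[R]_J := _ - 1%:M.
have QM : trunc_bmap U J - 1%:M = map_mx (real_complex R) Q.
  rewrite map_mxB map_mx1; congr (_ - _).
  by apply/matrixP => j k; rewrite !mxE.
have capC := ker_im_proj_cap U J.
rewrite /trunc_proj /ker_im_proj -map_trmx; congr trmx.
rewrite QM map_trmx in capC *; set V := Q^T in capC *.
have cap : (kermx V :&: V = 0)%MS.
  apply/eqP/rowV0P => v vV; apply: (@map_mx_inj _ _ (real_complex R)).
  rewrite map_mx0; apply/eqP; rewrite -submx0 -capC.
  by move: vV; rewrite !sub_capmx -map_kermx !map_submx.
have full : (1%:M <= kermx V + V)%MS.
  rewrite sub1mx /row_full mxrank_disjoint_sum// mxrank_ker subnK//.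
  exact: rank_leq_row.
set P := proj_mx (kermx V) V.
have P1 : (P <= kermx V)%MS by rewrite -[P]mul1mx proj_mx_sub.
have P2 : (1%:M - P <= V)%MS.
  by rewrite -[X in _ - X]mul1mx proj_mx_compl_sub.
rewrite -[LHS]mul1mx -(map_mx1 (real_complex R)) -[1%:M](subrKC P) map_mxD mulmxDl.
rewrite proj_mx_id// ?[X in _ + X]proj_mx_0 ?addr0// ?map_submx//.
by rewrite -map_kermx map_submx.
Qed.

Lemma trunc_entropyCE (R : realType) (mu : weights R) (U : contraction mu)
    (J : nat) :
  trunc_entropyC U J = (trunc_entropy U J)%:C.
Proof.
suff [r h] : exists r : R, trunc_entropyC U J = r%:C.
  by rewrite /trunc_entropy h.
rewrite /trunc_entropyC trunc_projE; set P := ker_im_proj _.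
exists (- \sum_(j < J) \sum_(k < J)
  (P^T *m (const_mx 1 : 'cV_J)) j 0 * bmap U j k *
  (P *m (\col_i mu i)) k 0 * ln (bmap U j k)).
have -> : const_mx 1 = map_mx (real_complex R) (const_mx 1) :> 'cV_J.
  by rewrite map_const_mx rmorph1.
have -> : \col_(i < J) (mu i)%:C = map_mx (real_complex R) (\col_i mu i).
  by apply/colP => i; rewrite !mxE.
rewrite map_trmx -!map_mxM rmorphN rmorph_sum; congr (- _).
apply: eq_bigr => j _; rewrite rmorph_sum; apply: eq_bigr => k _.
by rewrite 3!rmorphM; congr (_ * _ * _ * _); rewrite ?[LHS]mxE.
Qed.

(* The fraktur H(U); meaningful when [trunc_entropy U] converges. *)
Definition limit_trunc_entropy (R : realType) (mu : weights R) (U : contraction mu) : R :=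
  limn (trunc_entropy U).

Record automorphism (R : realType) (mu : weights R) := Automorphism {
  aut_fun :> nat -> nat;
  aut_bij : bijective aut_fun;
  aut_weight : forall j, mu (aut_fun j) = mu j }.

Lemma l2sum_comp (R : realType) (mu : weights R) (F : automorphism mu)
    (x : nat -> R[i]) :
  l2sum mu (x \o F) = l2sum mu x.
Proof.
rewrite /l2sum !nneseries_esumT => [|j|j]; [|exact: l2term_ge0..].
rewrite (@reindex_esum _ _ _ setT setT F (fun j => (mu j * cmod (x j) ^+ 2)%:E)).
  by apply: eq_esum => j _ /=; rewrite aut_weight.
rewrite setTT_bijective; exact: aut_bij.
Qed.

Lemma in_l2_comp (R : realType) (mu : weights R) (F : automorphism mu)
    (x : l2 mu) :
  (x : nat -> R[i]) \o F \in in_l2 mu.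
Proof.
apply: asboolT; rewrite l2sum_comp.
by case: x => f fP; exact: (asboolP _ fP).
Qed.

Definition koopman_fun (R : realType) (mu : weights R) (F : automorphism mu)
  (x : l2 mu) : l2 mu := L2 (in_l2_comp F x).

Lemma koopman_linear (R : realType) (mu : weights R) (F : automorphism mu) :
  linear (koopman_fun F).
Proof. by move=> a x y; apply: val_inj. Qed.

HB.instance Definition _ (R : realType) (mu : weights R)
    (F : automorphism mu) :=
  GRing.isLinear.Build R[i] (l2 mu) (l2 mu) _ (koopman_fun F)
    (koopman_linear F).

Lemma koopman_le (R : realType) (mu : weights R) (F : automorphism mu)
    (x : l2 mu) :
  l2norm (koopman_fun F x) <= l2norm x.
Proof. by rewrite /l2norm l2sum_comp. Qed.

Definition koopman (R : realType) (mu : weights R) (F : automorphism mu) :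
  contraction mu := Contraction (koopman_le F).

(* Main.v *)
Require Import Defs.
From mathcomp Require Import all_boot all_order all_algebra.
From mathcomp Require Import complex ring lra.
From mathcomp Require Import all_classical all_reals all_analysis.

Set Implicit Arguments.
Unset Strict Implicit.
Unset Printing Implicit Defensive.

Import Order.TTheory GRing.Theory Num.Theory.
Import numFieldNormedType.Exports.

Local Open Scope classical_set_scope.
Local Open Scope ring_scope.

(** The matrix b(U_F) is the permutation matrix of F, so every logarithm in the
entropy of a truncation is ln 0 or ln 1, both equal to 0 here.  For h(U_F), the
path weights are the masses of the classes obtained by grouping the atoms mu_j
according to their itinerary under F.  By subadditivity of - x ln x, the atoms
with j < J contribute at most the constant \sum_(j < J) - mu_j ln mu_j, and by
Gibbs' inequality the remaining atoms, of total mass eps, contribute at most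
eps (n + 1) ln (K + 1) + 1.  Divided by n, this is O(eps). *)

(** * Subadditivity and Gibbs bounds for -x ln x *)

Section ShannonBound.
Variable R : realType.

Definition neg_xlnx (x : R) : R := - (x * ln x).

(** Monotonicity of ln gives a ln a <= a ln (a + b); this is applied to both terms of x ln (x + y) +
    y ln (x + y). *)
Lemma neg_xlnxD (x y : R) : 0 <= x -> 0 <= y ->
  neg_xlnx (x + y) <= neg_xlnx x + neg_xlnx y.
Proof.
have mono (a b : R) : 0 <= a -> 0 <= b -> a * ln a <= a * ln (a + b).
  rewrite le_eqVlt => /predU1P[<- _|a0 b0]; first by rewrite !mul0r.
  rewrite ler_pM2l// ler_ln ?posrE ?lerDl//.
  exact: ltr_wpDr.
move=> x0 y0; rewrite /neg_xlnx -opprD lerN2 mulrDl lerD ?mono//.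
by rewrite [x + y]addrC mono.
Qed.

Lemma neg_xlnx_sum (I : Type) (r : seq I) (P : pred I) (a : I -> R) :
  (forall i, P i -> 0 <= a i) ->
  neg_xlnx (\sum_(i <- r | P i) a i) <= \sum_(i <- r | P i) neg_xlnx (a i).
Proof.
move=> a0.
(* Nonnegativity joins the induction because [neg_xlnxD] requires it of the partial sums. *)
suff [] : 0 <= \sum_(i <- r | P i) a i /\
  neg_xlnx (\sum_(i <- r | P i) a i) <= \sum_(i <- r | P i) neg_xlnx (a i) by [].
apply: (big_ind2 (fun x y => 0 <= x /\ neg_xlnx x <= y)).
- by rewrite /neg_xlnx mul0r oppr0.
- move=> x1 x2 y1 y2 [? h1] [? h2]; split; first exact: addr_ge0.
  exact: le_trans (neg_xlnxD _ _) (lerD h1 h2).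
- by move=> i Pi; split=> //; exact: a0.
Qed.

Lemma neg_xlnx_ge0 (x : R) : 0 <= x <= 1 -> 0 <= neg_xlnx x.
Proof. by case/andP=> x0 x1; rewrite /neg_xlnx -mulrN mulr_ge0// oppr_ge0 ln_le0. Qed.

(** This is ln y <= y at y = 1 / (L x), multiplied by x. When L is the number of classes, the terms
    1 / L add up to 1. *)
Lemma neg_xlnx_gibbs (x L : R) : 0 <= x -> 0 < L ->
  neg_xlnx x <= x * ln L + L^-1.
Proof.
rewrite le_eqVlt => /predU1P[<-|x0] L0.
  by rewrite /neg_xlnx !mul0r oppr0 add0r invr_ge0 ltW.
have Lx : 0 < L * x by rewrite mulr_gt0.
have := ltW (@ln_sublinear R (L * x)^-1 _); rewrite invr_gt0 => /(_ Lx).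
rewrite lnV ?lnM ?posrE// -(ler_pM2l x0) invfM mulrCA divff ?gt_eqF// mulr1.
by rewrite /neg_xlnx => h; lra.
Qed.

End ShannonBound.

(** * Entropy of a finite grouping of the atoms of mu *)

Section FactorOfAtoms.
Variables (R : realType) (mu : weights R) (S : finType) (f : nat -> S).

(** The push-forward of mu under [f], evaluated at [s]; [fine] loses nothing, since the series is at
    most 1. *)
Definition fiber_mass (s : S) : R :=
  fine (\sum_(0 <= j <oo) ((f j == s)%:R * mu j)%:E)%E.

Let fiber_term_ge0 s j : (0 <= ((f j == s)%:R * mu j)%:E)%E.
Proof. by rewrite lee_fin mulr_ge0// ltW// weight_gt0. Qed.

Let fiber_massE s :
  (\sum_(0 <= j <oo) ((f j == s)%:R * mu j)%:E = (fiber_mass s)%:E)%E.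
Proof.
rewrite fineK// ge0_fin_numE; last by apply: nneseries_ge0.
apply: (@le_lt_trans _ _ 1%E); last by rewrite ltry.
rewrite -(weight_sum1 mu); apply: lee_nneseries => // j _.
rewrite lee_fin ler_piMl ?(ltW (weight_gt0 mu j))//.
by rewrite lern1 leq_b1.
Qed.

Lemma fiber_mass_sum : \sum_s fiber_mass s = 1.
Proof.
apply: EFin_inj; rewrite -sumEFin -(weight_sum1 mu).
under eq_bigr do rewrite -fiber_massE.
rewrite -nneseries_sum//; apply: eq_eseriesr => j _.
rewrite sumEFin -mulr_suml (bigD1 (f j))//= eqxx big1 ?addr0 ?mul1r//.
by move=> s /negPf; rewrite eq_sym => ->.
Qed.

Lemma fiber_mass_ge (J : nat) s :
  \sum_(j < J) (f j == s)%:R * mu j <= fiber_mass s.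
Proof.
rewrite -lee_fin -fiber_massE -sumEFin -(big_mkord xpredT (fun j => ((f j == s)%:R * mu j)%:E)).
exact: nneseries_lim_ge.
Qed.

Lemma fiber_mass_ge0 s : 0 <= fiber_mass s.
Proof. by have := fiber_mass_ge 0 s; rewrite big_ord0. Qed.

Lemma fiber_mass_le1 s : fiber_mass s <= 1.
Proof.
rewrite -fiber_mass_sum (bigD1 s)//= lerDl sumr_ge0// => t _.
exact: fiber_mass_ge0.
Qed.

(** The first sum depends neither on [f] nor on [S], so it stays fixed when itineraries get longer;
    only the tail mass is multiplied by ln #|S|. *)
Lemma fiber_entropy_le (J : nat) :
  \sum_s neg_xlnx (fiber_mass s) <=
  \sum_(j < J) neg_xlnx (mu j) + (1 - \sum_(j < J) mu j) * ln #|S|%:R + 1.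
Proof.
have S0 : 0 < #|S|%:R :> R by rewrite ltr0n; apply/card_gt0P; exists (f 0).
(* The part of the mass of class [s] carried by the atoms below [J]; the remainder is bounded by
   Gibbs with L = #|S|. *)
pose a s := \sum_(j < J | f j == s) mu j.
have a0 s : 0 <= a s by apply: sumr_ge0 => j _; rewrite ltW// weight_gt0.
have am s : a s <= fiber_mass s.
  apply: le_trans (fiber_mass_ge J s); rewrite /a big_mkcond le_eqVlt.
  apply/orP; left; apply/eqP; apply: eq_bigr => j _.
  by case: eqP; rewrite ?mul1r ?mul0r.
have suma (g : nat -> R) : \sum_s \sum_(j < J | f j == s) g j = \sum_(j < J) g j.
  by rewrite [RHS](partition_big (fun j : 'I_J => f j) xpredT).
apply: (@le_trans _ _ (\sum_s (\sum_(j < J | f j == s) neg_xlnx (mu j) +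
    ((fiber_mass s - a s) * ln #|S|%:R + #|S|%:R^-1)))).
  apply: ler_sum => s _; rewrite -[X in neg_xlnx X](subrKC (a s)).
  apply: le_trans (neg_xlnxD _ _) _; rewrite ?subr_ge0//.
  rewrite lerD ?neg_xlnx_gibbs ?subr_ge0//.
  by apply: neg_xlnx_sum => j _; rewrite ltW// weight_gt0.
rewrite 2!big_split/= (suma (fun j => neg_xlnx (mu j))).
rewrite -mulr_suml sumrB fiber_mass_sum (suma mu).
by rewrite sumr_const -[X in _ + (_ + X)]mulr_natr mulVf ?gt_eqF// addrA.
Qed.

End FactorOfAtoms.

(** * The matrix, truncations and path weights of the Koopman operator *)

Section Koopman.
Variables (R : realType) (mu : weights R) (F : automorphism mu).

(** Column k of the operator is delta_k composed with F; where it is nonzero, k = F(j) and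
    invariance makes the ratio mu_j / mu_k equal to 1. *)
Lemma koopman_bmap (j k : nat) : bmap (koopman F) j k = (F j == k)%:R.
Proof.
rewrite /bmap (_ : op_entry _ j k = (F j == k)%:R)//.
case: eqP => [<-|_]; last by rewrite cmod0 expr0n mulr0.
by rewrite aut_weight divff ?gt_eqF ?weight_gt0// cmod1 expr1n mulr1.
Qed.

Lemma koopman_trunc_entropy (J : nat) : trunc_entropy (koopman F) J = 0.
Proof.
rewrite /trunc_entropy /trunc_entropyC big1 ?oppr0// => j _.
rewrite big1// => k _.
by rewrite koopman_bmap; case: (_ == _); rewrite ?ln1 ?ln0// mulr0.
Qed.

(* By [koopman_bmap] the path j_0, ..., j_n has nonzero weight iff
   j_i = F(j_{i+1}) for all i, so j_n determines it. *)
Definition backward_path (n j : nat) : {ffun 'I_n.+1 -> nat} :=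
  [ffun i : 'I_n.+1 => iter (n - i) F j].

Lemma backward_path_inj (n : nat) : injective (backward_path n).
Proof.
move=> j k /ffunP/(_ ord_max); rewrite !ffunE /= subnn; exact.
Qed.

Lemma prod_koopman_bmap (n : nat) (p : {ffun 'I_n.+1 -> nat}) :
  \prod_(i < n) bmap (koopman F) (p (inord i.+1)) (p (inord i)) =
  (p == backward_path n (p ord_max))%:R.
Proof.
have pathP : reflect (forall i : 'I_n, F (p (inord i.+1)) = p (inord i))
    (p == backward_path n (p ord_max)).
  apply: (iffP eqP) => [-> i|pF].
    by rewrite !ffunE !inordK ?ltnS ?ltn_ord 1?ltnW// -iterS -subSn.
  apply/ffunP => i; rewrite ffunE.
  (* The path is recovered from its last coordinate downwards. *)
  suff H k : (k <= n)%N -> p (inord (n - k)) = iter k F (p ord_max).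
    by rewrite -H ?leq_subr// subKn ?inord_val// -ltnS.
  elim: k => [|k IH] kn.
    by rewrite subn0; congr (p _); apply: val_inj; rewrite /= inordK.
  have h : (n - k.+1 < n)%N by rewrite ltn_subrL (leq_trans _ kn).
  by rewrite iterS -IH 1?ltnW// -(pF (Ordinal h))/= -subSn.
case: pathP => [pF|npF].
  by apply: big1 => i _; rewrite koopman_bmap pF eqxx.
have [i /eqP/negPf pi] : exists i : 'I_n, F (p (inord i.+1)) <> p (inord i).
  by apply/existsNP.
by apply/eqP/prodf_eq0; exists i => //; rewrite koopman_bmap pi.
Qed.

(** A partition enters as a colouring [col]. Time runs backwards: coordinate i is the colour of F^(n
    - i)(j), and the last one that of j. *)
Definition itinerary (K : nat) (col : nat -> 'I_K.+1) (n j : nat) :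
    {ffun 'I_n.+1 -> 'I_K.+1} :=
  [ffun i => col (backward_path n j i)].

(** Only backward paths contribute, and each is indexed by its endpoint j_n. Invariance replaces
    mu(j_0) by mu(j_n), and the indicators select the points with itinerary [s]. *)
Lemma koopman_path_weight (K : nat) (X : 'I_K.+1 -> set nat)
    (col : nat -> 'I_K.+1) (n : nat) (s : {ffun 'I_n.+1 -> 'I_K.+1}) :
  (forall k j, X k j <-> k = col j) ->
  path_weight (koopman F) X s = fiber_mass mu (itinerary col n) s.
Proof.
move=> colP; rewrite /path_weight /fiber_mass; congr fine.
transitivity (\esum_(p in range (backward_path n))
  ((\prod_(i < n.+1) (\1_(X (s i)) (p i) : R)) * mu (p ord0))%:E).
  rewrite [RHS]esum_mkcond; apply: eq_esum => p _.
  rewrite prod_koopman_bmap; case: eqP => [pE|npE].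
    by rewrite mem_set ?mulr1//; exists (p ord_max).
  rewrite mulr0 mul0r memNset// => -[j _ pE]; apply: npE.
  by rewrite -pE ffunE /= subnn.
rewrite esum_set_image; last 2 first.
- move=> j _; rewrite lee_fin mulr_ge0 ?(ltW (weight_gt0 _ _))//.
  by apply: prodr_ge0 => i _; rewrite indicE.
- by move=> j k _ _; exact: backward_path_inj.
have muiter m j : mu (iter m F j) = mu j.
  by elim: m => //= m IH; rewrite aut_weight.
rewrite (eq_eseriesl (Q := xpredT)); last by move=> j; rewrite in_setT.
apply: eq_eseriesr => j _; congr (_ * _)%:E; last by rewrite ffunE muiter.
have [sE|nsE] := eqVneq.
  apply: big1 => i _; rewrite indicE mem_set//; apply/colP.
  by rewrite -sE ffunE.
have [i /eqP ni] : exists i, itinerary col n j i != s i.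
  by apply/existsP; apply: contra_neqT nsE => /existsPn h;
     apply/ffunP => i; apply/eqP/negPn/h.
apply/eqP/prodf_eq0; exists i => //; rewrite indicE memNset//.
by move/colP => si; apply: ni; rewrite si ffunE.
Qed.

(** * Entropy rates of finite partitions *)

Lemma partition_color (K : nat) (X : 'I_K.+1 -> set nat) :
  partition [set: 'I_K.+1] X [set: nat] ->
  exists col : nat -> 'I_K.+1, forall k j, X k j <-> k = col j.
Proof.
case=> Xcov /trivIsetP Xtriv _.
have /choice[col colP] : forall j, exists k, X k j.
  move=> j; have : cover [set: 'I_K.+1] X j by rewrite Xcov.
  by case=> k _ Xkj; exists k.
exists col => k j; split => [Xkj|->//].
apply/eqP/negPn/negP => kj.
have := Xtriv k (col j) I I kj.
by move=> /(congr1 (fun A => A j))/= => <-; split.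
Qed.

Lemma koopman_entropy_rate_cvg (K : nat) (X : 'I_K.+1 -> set nat) :
  partition [set: 'I_K.+1] X [set: nat] ->
  entropy_rate_seq (koopman F) X n @[n --> \oo] --> (0 : R).
Proof.
move=> /partition_color[col colP].
have bE n : block_entropy (koopman F) X n =
    \sum_s neg_xlnx (fiber_mass mu (itinerary col n) s).
  rewrite /block_entropy -sumrN; apply: eq_bigr => s _.
  by rewrite (@koopman_path_weight K X col n s).
apply/cvgrPdist_le => e e0.
pose l : R := ln K.+1%:R.
have l0 : 0 <= l by rewrite ln_ge0// ler1n.
(* Chosen so that d l <= e / 4: as n + 1 <= 2 n, the tail costs at most e n / 2, and n >= 2 C / e
   leaves the other half to [C]. The + 1 keeps the denominator positive when K = 0. *)
pose d := e / (4 * (l + 1)).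
have d0 : 0 < d by rewrite divr_gt0//; lra.
have [J HJ] : exists J, 1 - \sum_(j < J) mu j <= d.
  have : series (fun j => mu j) n @[n --> \oo] --> (1 : R).
    have := @is_cvg_nneseries R (fun j => (mu j)%:E) xpredT 0.
    rewrite weight_sum1 => mu1; apply: (@fine_cvg _ _ _ _ (fun n => (series mu n)%:E)).
    rewrite /series /=; under eq_fun do rewrite -sumEFin.
    by apply: mu1 => j _ _; rewrite lee_fin ltW// weight_gt0.
  move=> /cvgrPdist_le/(_ d d0)[J _ /(_ J (leqnn J))].
  rewrite /series /= big_mkord => h; exists J.
  exact: le_trans (ler_norm _) h.
pose C := \sum_(j < J) neg_xlnx (mu j) + 1.
near=> n.
have n0 : 0 < n%:R :> R by rewrite ltr0n; near: n; exact: nbhs_infty_gt.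
have n1 : 1 <= n%:R :> R by rewrite ler1n -(@ltr0n R).
have nC : 2 * C / e <= n%:R by near: n; exact: nbhs_infty_ger.
have H0 : 0 <= block_entropy (koopman F) X n.
  rewrite bE sumr_ge0// => s _.
  by rewrite neg_xlnx_ge0// fiber_mass_ge0 fiber_mass_le1.
have H1 : block_entropy (koopman F) X n <= C + d * (l * (n%:R + 1)).
  rewrite bE; apply: le_trans (fiber_entropy_le _ _ J) _.
  (* There are (K + 1)^(n + 1) colour words, so ln #|S| = (n + 1) l. *)
  rewrite /C addrAC lerD2l card_ffun !card_ord natrX lnXn ?ltr0n//.
  by rewrite -[X in _ * X <= _]mulr_natr -[n.+1%:R]natr1 ler_wpM2r// mulr_ge0// addr_ge0.
rewrite sub0r normrN /entropy_rate_seq ger0_norm; last first.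
  by rewrite mulr_ge0// invr_ge0 ltW.
rewrite mulrC ler_pdivrMr//; apply: le_trans H1 _.
have dl : d * l <= e / 4.
  have -> : e / 4 = d * (l + 1) by rewrite /d; field; lra.
  by rewrite ler_pM2l//; lra.
move: nC; rewrite ler_pdivrMr// => nC.
have : d * l * (n%:R + 1) <= e / 4 * (2 * n%:R).
  by apply: ler_pM; rewrite ?(mulr_ge0 (ltW d0) l0)//; lra.
lra.
Unshelve. all: by end_near.
Qed.

Lemma koopman_entropy : entropy (koopman F) = 0%E.
Proof.
have rate0 (K : nat) (X : 'I_K.+1 -> set nat) :
    partition [set: 'I_K.+1] X [set: nat] -> entropy_rate (koopman F) X = 0.
  by move=> /koopman_entropy_rate_cvg/cvg_lim; apply.
rewrite /entropy (_ : [set h | _] = [set 0%E]) ?ereal_sup1//.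
apply/seteqP; split => [_ [K [X [/rate0 -> ->]]]//|_ ->].
(* The one-class partition shows that the set of rates is nonempty; the supremum of an empty set
   would be -oo. *)
exists 0%N, (fun=> setT); suff P : partition [set: 'I_1] (fun=> setT) [set: nat].
  by split=> //; rewrite rate0.
split; last by move=> _ _; exists 0%N.
- by apply/seteqP; split => // j _; exists ord0.
- by apply/trivIsetP => i j _ _; rewrite !ord1 eqxx.
Qed.

End Koopman.

(* The two convergence clauses say that the limits defining both entropies
   exist. *)
Theorem lemma9p2 (R : realType) (mu : weights R) (F : automorphism mu) :
  [/\ cvgn (trunc_entropy (koopman F)),
      limit_trunc_entropy (koopman F) = 0,
      forall (K : nat) (X : 'I_K.+1 -> set nat),
        partition [set: 'I_K.+1] X [set: nat] ->
        cvgn (entropy_rate_seq (koopman F) X)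
    & entropy (koopman F) = 0%E].
Proof.
have trunc0 : trunc_entropy (koopman F) = cst 0.
  by apply/funext => J; exact: koopman_trunc_entropy.
split; last exact: koopman_entropy.
- by rewrite trunc0; exact: is_cvg_cst.
- by rewrite /limit_trunc_entropy trunc0 lim_cst.
- move=> K X XP; apply/cvg_ex; exists (0 : R).
  exact: koopman_entropy_rate_cvg XP.
Qed.
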